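(* The only zero-divisor functorial family $\{\mathcal{R}_A\}$ for which the associated zero-divisor functor $\zeta:\mathbf{CRing}\to\mathbf{Graph}$ preserves all finite limits is the trivial functorial family $\{=_A\}$.
   Context: $\mathbf{CRing}$ is the category of commutative unitary rings with homomorphisms preserving $1$. $\mathbf{Graph}$ is the category whose objects are graphs (a set $V$ with a symmetric binary relation $E$ on $V$; loops allowed) and whose morphisms are maps on vertices sending adjacent pairs to adjacent pairs. An equivalence relation $\mathcal{R}$ on a ring $A$ is a zero-divisor relation if, whenever $a\,\mathcal{R}\,a'$ and $b\,\mathcal{R}\,b'$, $ab=0$ implies $a'b'=0$. A zero-divisor functorial family $\{\mathcal{R}_A\}$ is a choice, for each ring $A$, of a zero-divisor relation $\mathcal{R}_A$ on $A$ such that for every ring homomorphism $f:A\to B$, $a\,\mathcal{R}_A\,a'$ implies $f(a)\,\mathcal{R}_B\,f(a')$. The trivial functorial family is the one where every $\mathcal{R}_A$ is equality on $A$. The associated zero-divisor functor $\zeta$ sends $A$ to the graph $\zeta(A)$ with vertex set $A/\mathcal{R}_A$ in which $[a],[b]$ are adjacent iff $ab=0$, and sends $f:A\to B$ to $\zeta(f):[a]\mapsto[f(a)]$. *)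

(* Defs.v *)
From HB Require Import structures.
From Corelib Require Import RelationClasses.
From Stdlib Require FinFun.
From mathcomp Require Import all_boot all_order all_algebra generic_quotient.
From mathcomp Require Import boolp.

Set Implicit Arguments.
Unset Strict Implicit.
Unset Printing Implicit Defensive.

Import GRing.Theory.
Local Open Scope ring_scope.
Local Open Scope quotient_scope.

Record category := Category {
  obj : Type;
  hom : obj -> obj -> Type;
  idm : forall a, hom a a;
  comp : forall a b c, hom b c -> hom a b -> hom a c;
  comp_idl : forall a b (f : hom a b), comp (idm b) f = f;
  comp_idr : forall a b (f : hom a b), comp f (idm a) = f;
  comp_assoc : forall a b c d (h : hom c d) (g : hom b c) (f : hom a b),
    comp h (comp g f) = comp (comp h g) f
}.
Arguments hom {c0} _ _ : rename.
Arguments idm {c0} a : rename.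
Arguments comp {c0 a b c} _ _ : rename.

Record functor (C D : category) := Functor {
  fobj :> obj C -> obj D;
  fmap : forall a b, hom a b -> hom (fobj a) (fobj b);
  fmap_id : forall a, fmap (idm a) = idm (fobj a);
  fmap_comp : forall a b c (g : hom b c) (f : hom a b),
    fmap (comp g f) = comp (fmap g) (fmap f)
}.
Arguments fmap {C D} f {a b} _ : rename.

Section FunctorComp.
Variables (C D E : category) (G : functor D E) (F : functor C D).

Lemma functor_comp_id a : fmap G (fmap F (idm a)) = idm (G (F a)).
Proof. by rewrite !fmap_id. Qed.

Lemma functor_comp_comp a b c (g : hom b c) (f : hom a b) :
  fmap G (fmap F (comp g f)) = comp (fmap G (fmap F g)) (fmap G (fmap F f)).
Proof. by rewrite !fmap_comp. Qed.

Definition functor_comp : functor C E :=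
  @Functor C E (fun a => G (F a)) (fun a b f => fmap G (fmap F f))
    functor_comp_id functor_comp_comp.
End FunctorComp.

Record cone (J C : category) (D : functor J C) := Cone {
  apex : obj C;
  leg : forall j, hom apex (D j);
  leg_natural : forall i j (u : hom i j), comp (fmap D u) (leg i) = leg j
}.
Arguments leg {J C D} c j : rename.

Definition is_limit (J C : category) (D : functor J C) (c : cone D) : Prop :=
  forall c' : cone D,
    exists! u : hom (apex c') (apex c), forall j, comp (leg c j) u = leg c' j.

Section MapCone.
Variables (J C D : category) (F : functor C D) (X : functor J C) (c : cone X).

Lemma map_cone_natural i j (u : hom i j) :
  comp (fmap (functor_comp F X) u) (fmap F (leg c i)) = fmap F (leg c j).
Proof. by rewrite -(leg_natural c u) fmap_comp. Qed.

Definition map_cone : cone (functor_comp F X) := Cone map_cone_natural.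
End MapCone.

(** Not [cardinality.finite_set]: [set T] bounds the universe of [T] by that of
    the objects of mathcomp structures, which would keep [CRing] from being a
    [category]. *)
Definition finite_category (J : category) : Prop :=
  FinFun.Finite (obj J) /\ forall a b : obj J, FinFun.Finite (hom a b).

Definition preserves_finite_limits (C D : category) (F : functor C D) : Prop :=
  forall J : category, finite_category J ->
  forall (X : functor J C) (c : cone X), is_limit c -> is_limit (map_cone F c).

(** The zero ring is an object, hence [comPzRingType] and not
    [comNzRingType]; it is the terminal object. *)

Lemma rmorphism_ext (A B : comPzRingType) (f g : {rmorphism A -> B}) :
  f =1 g -> f = g.
Proof.
case: f => f [[fD] [fM]]; case: g => g [[gD] [gM]] /= /funext fg.
by subst g; rewrite (Prop_irrelevance fD gD) (Prop_irrelevance fM gM).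
Qed.

Definition cring_hom (A B : comPzRingType) : Type := {rmorphism A -> B}.

Definition cring_id (A : comPzRingType) : cring_hom A A :=
  (idfun : {rmorphism A -> A}).

Definition cring_comp (A B C : comPzRingType)
  (g : cring_hom B C) (f : cring_hom A B) : cring_hom A C :=
  ((g : {rmorphism B -> C}) \o (f : {rmorphism A -> B}) : {rmorphism A -> C}).

Lemma cring_comp_idl A B (f : cring_hom A B) : cring_comp (cring_id B) f = f.
Proof. exact: rmorphism_ext. Qed.

Lemma cring_comp_idr A B (f : cring_hom A B) : cring_comp f (cring_id A) = f.
Proof. exact: rmorphism_ext. Qed.

Lemma cring_comp_assoc A B C D (h : cring_hom C D) (g : cring_hom B C)
    (f : cring_hom A B) :
  cring_comp h (cring_comp g f) = cring_comp (cring_comp h g) f.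
Proof. exact: rmorphism_ext. Qed.

Definition CRing : category :=
  Category cring_comp_idl cring_comp_idr cring_comp_assoc.

Record graph := MkGraph {
  vertex :> Type;
  adj : vertex -> vertex -> Prop;
  adj_sym : forall x y, adj x y -> adj y x
}.
Arguments adj {g} _ _ : rename.

Record graph_hom (G H : graph) := GraphHom {
  graph_fun :> G -> H;
  graph_hom_adj : forall x y, adj x y -> adj (graph_fun x) (graph_fun y)
}.

Lemma graph_hom_ext (G H : graph) (f g : graph_hom G H) : f =1 g -> f = g.
Proof.
case: f => f fP; case: g => g gP /= /funext fg.
by subst g; rewrite (Prop_irrelevance fP gP).
Qed.

Definition graph_id (G : graph) : graph_hom G G :=
  @GraphHom G G id (fun _ _ xy => xy).

Definition graph_comp (G H K : graph) (g : graph_hom H K) (f : graph_hom G H) :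
    graph_hom G K :=
  @GraphHom G K (g \o f)
    (fun _ _ xy => graph_hom_adj g (graph_hom_adj f xy)).

Lemma graph_comp_idl G H (f : graph_hom G H) : graph_comp (graph_id H) f = f.
Proof. exact: graph_hom_ext. Qed.

Lemma graph_comp_idr G H (f : graph_hom G H) : graph_comp f (graph_id G) = f.
Proof. exact: graph_hom_ext. Qed.

Lemma graph_comp_assoc G H K L (h : graph_hom K L) (g : graph_hom H K)
    (f : graph_hom G H) :
  graph_comp h (graph_comp g f) = graph_comp (graph_comp h g) f.
Proof. exact: graph_hom_ext. Qed.

Definition Graph : category :=
  Category graph_comp_idl graph_comp_idr graph_comp_assoc.

Record zd_relation (A : comPzRingType) (r : A -> A -> Prop) : Prop :=
  ZdRelation {
    zd_equivalence : Equivalence r;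
    zd_mul_eq0 : forall a a' b b',
      r a a' -> r b b' -> a * b = 0 -> a' * b' = 0
  }.

Record zd_family := ZdFamily {
  zd_rel :> forall A : comPzRingType, A -> A -> Prop;
  zd_relP : forall A : comPzRingType, zd_relation (@zd_rel A);
  zd_functorial : forall (A B : comPzRingType) (f : {rmorphism A -> B}) a a',
    zd_rel a a' -> zd_rel (f a) (f a')
}.

Lemma eq_zd_relation (A : comPzRingType) : zd_relation (@eq A).
Proof. by split=> [|a _ b _ <- <-]; first exact: eq_equivalence. Qed.

Lemma eq_zd_functorial (A B : comPzRingType) (f : {rmorphism A -> B}) a a' :
  a = a' -> f a = f a'.
Proof. by move->. Qed.

Definition trivial_zd_family : zd_family :=
  @ZdFamily (fun A => @eq A) eq_zd_relation eq_zd_functorial.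

Section ZeroDivisorGraph.
Variables (R : zd_family) (A : comPzRingType).

(** [{eq_quot _}] quotients by a boolean relation; [`[< _ >]] is the boolean
    reflection of an arbitrary proposition. *)
Definition zd_relb : rel A := fun a b => `[< R A a b >].

Lemma zd_relb_refl : reflexive zd_relb.
Proof. by move=> a; apply/asboolP; case: (zd_relP R A) => -[+ _ _ _]; apply. Qed.

Lemma zd_relb_sym : symmetric zd_relb.
Proof.
case: (zd_relP R A) => -[_ Rsym _ _] a b.
by apply/asboolP/asboolP; apply: Rsym.
Qed.

Lemma zd_relb_trans : transitive zd_relb.
Proof.
case: (zd_relP R A) => -[_ _ Rtrans _] b a c /asboolP ab /asboolP bc.
by apply/asboolP; apply: Rtrans ab bc.
Qed.

Canonical zd_equiv := EquivRel zd_relb zd_relb_refl zd_relb_sym zd_relb_trans.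

Definition zd_quot : Type := {eq_quot zd_relb}.

Definition zd_class (a : A) : zd_quot := \pi_{eq_quot zd_relb} a.

Lemma zd_classP (a b : A) : zd_class a = zd_class b <-> R A a b.
Proof. by split=> [/eqmodP/asboolP|ab] //; apply/eqmodP/asboolP. Qed.

Definition zd_repr (x : zd_quot) : A := repr (x : {eq_quot zd_relb}).

Lemma zd_reprK (x : zd_quot) : zd_class (zd_repr x) = x.
Proof. exact: (@reprK _ {eq_quot zd_relb}). Qed.

Definition zd_adj (x y : zd_quot) : Prop := zd_repr x * zd_repr y = 0.

Lemma zd_adjE (a b : A) : zd_adj (zd_class a) (zd_class b) <-> a * b = 0.
Proof.
have Rr c : R A (zd_repr (zd_class c)) c by apply/zd_classP; rewrite zd_reprK.
have rR c : R A c (zd_repr (zd_class c)) by apply/zd_classP; rewrite zd_reprK.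
by split; apply: (zd_mul_eq0 (zd_relP R A)).
Qed.

Lemma zd_adj_sym x y : zd_adj x y -> zd_adj y x.
Proof. by rewrite /zd_adj mulrC. Qed.

Definition zd_graph : graph := MkGraph zd_adj_sym.
End ZeroDivisorGraph.

Section ZeroDivisorFunctor.
Variable R : zd_family.

Definition zd_fun (A B : comPzRingType) (f : {rmorphism A -> B})
  (x : zd_quot R A) : zd_quot R B := zd_class R (f (zd_repr x)).

Lemma zd_funE (A B : comPzRingType) (f : {rmorphism A -> B}) a :
  zd_fun f (zd_class R a) = zd_class R (f a).
Proof.
by apply/zd_classP/zd_functorial; apply/zd_classP; rewrite zd_reprK.
Qed.

Lemma zd_fun_adj (A B : comPzRingType) (f : {rmorphism A -> B}) x y :
  zd_adj x y -> zd_adj (zd_fun f x) (zd_fun f y).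
Proof. by move=> xy; apply/zd_adjE; rewrite -rmorphM [_ * _]xy rmorph0. Qed.

Definition zd_map (A B : comPzRingType) (f : {rmorphism A -> B}) :
    graph_hom (zd_graph R A) (zd_graph R B) :=
  @GraphHom (zd_graph R A) (zd_graph R B) (zd_fun f) (@zd_fun_adj A B f).

Lemma zd_map_id (A : obj CRing) : zd_map (@idm CRing A) = graph_id _.
Proof. by apply: graph_hom_ext => x; rewrite /= /zd_fun zd_reprK. Qed.

Lemma zd_map_comp (A B C : obj CRing)
    (g : @hom CRing B C) (f : @hom CRing A B) :
  zd_map (comp g f) = graph_comp (zd_map g) (zd_map f).
Proof.
apply: graph_hom_ext => x; rewrite -(zd_reprK x) /=.
by rewrite !zd_funE.
Qed.

Definition zd_functor : functor CRing Graph :=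
  @Functor CRing Graph (zd_graph R) zd_map zd_map_id zd_map_comp.
End ZeroDivisorFunctor.

(* Main.v *)
From HB Require Import structures.
From mathcomp Require Import all_boot all_order all_algebra ring_quotient.
From mathcomp Require Import boolp.
Require Import Defs.

Set Implicit Arguments.
Unset Strict Implicit.
Unset Printing Implicit Defensive.

Import GRing.Theory.
Local Open Scope ring_scope.

(** Both directions rest on the polynomial ring Z[t], whose morphisms into a
    ring B are the elements of B, the element u corresponding to evaluation at
    u ([int_poly_eval]).

    Suppose that the functor preserves finite limits, and let u ~ v in B.  The
    evaluations at u and v send t to related elements, so the class of t
    equalizes the two maps that they induce on classes.  As the functor
    preserves the equalizer of the two evaluations, t ~ e for some e with
    e(u) = e(v) ([preserves_equalizer_lift]).  Now 0 is related to itself only,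
    so reducing two related elements modulo either of them shows that they
    divide each other ([zd_rel_dvd]).  Hence t = c e with c a unit of Z[t],
    that is, a constant ([zd_rel_polyX]), and evaluating at u and at v gives
    u = c e(u) = c e(v) = v.

    Conversely, for the trivial family the graph of A has the elements of A as
    vertices.  Since Z[t] represents the underlying-set functor, the elements
    of a limit of rings are exactly the compatible families of elements of the
    rings of the diagram ([cring_limit_elements]); and a product of two such
    elements vanishes iff it vanishes in every component.  So the graph of the
    limit is the limit of the graphs, for diagrams of any shape. *)

(** * Evaluation of integer polynomials in a commutative ring *)

Section IntPolyEval.
Variables (B : comPzRingType) (x : B).

(** A sum, and not [horner] of a polynomial over B, so that B may be the zero
    ring. *)
Definition int_poly_eval (p : {poly int}) : B :=
  \sum_(i < size p) (p`_i)%:~R * x ^+ i.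

(** A bound common to several polynomials makes their sums comparable
    termwise. *)
Lemma int_poly_eval_wide n (p : {poly int}) : (size p <= n)%N ->
  int_poly_eval p = \sum_(i < n) (p`_i)%:~R * x ^+ i.
Proof.
move=> pn; rewrite /int_poly_eval.
rewrite (big_ord_widen n (fun i => (p`_i)%:~R * x ^+ i)) //.
rewrite big_mkcond; apply: eq_bigr => i _; case: ltnP => // pi.
by rewrite nth_default // mul0r.
Qed.

Lemma int_poly_eval_is_zmod_morphism : zmod_morphism int_poly_eval.
Proof.
move=> p q; pose n := maxn (size p) (size q).
rewrite !(@int_poly_eval_wide n) ?leq_maxl ?leq_maxr //; last first.
  by rewrite (leq_trans (size_polyD _ _)) // size_polyN.
rewrite -sumrB; apply: eq_bigr => i _.
by rewrite coefB rmorphB mulrBl.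
Qed.

HB.instance Definition _ := GRing.isZmodMorphism.Build {poly int} B
  int_poly_eval int_poly_eval_is_zmod_morphism.

Lemma int_poly_evalC (c : int) : int_poly_eval c%:P = c%:~R.
Proof.
rewrite (@int_poly_eval_wide 1) ?size_polyC_leq1 //.
by rewrite big_ord1 coefC /= mulr1.
Qed.

Lemma int_poly_evalMX p : int_poly_eval (p * 'X) = int_poly_eval p * x.
Proof.
rewrite (@int_poly_eval_wide (size p).+1); last first.
  by rewrite (leq_trans (size_polyMleq _ _)) // size_polyX addn2.
rewrite big_ord_recl coefMX mul0r add0r mulr_suml.
by apply: eq_bigr => i _; rewrite coefMX /= exprSr mulrA.
Qed.

Lemma int_poly_evalX : int_poly_eval 'X = x.
Proof. by rewrite -['X]mul1r int_poly_evalMX int_poly_evalC mul1r. Qed.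

Lemma int_poly_evalCM (c : int) p :
  int_poly_eval (c%:P * p) = c%:~R * int_poly_eval p.
Proof.
rewrite (@int_poly_eval_wide (size p)) ?mul_polyC ?size_scale_leq //.
rewrite mulr_sumr; apply: eq_bigr => i _.
by rewrite coefZ rmorphM mulrA.
Qed.

Lemma int_poly_eval_is_monoid_morphism : monoid_morphism int_poly_eval.
Proof.
split=> [|p q]; first exact: (int_poly_evalC 1).
elim/poly_ind: p => [|p c IHp]; first by rewrite mul0r raddf0 mul0r.
rewrite mulrDl mulrAC !raddfD /= !int_poly_evalMX IHp int_poly_evalCM.
by rewrite int_poly_evalC mulrDl mulrAC.
Qed.

HB.instance Definition _ := GRing.isMonoidMorphism.Build {poly int} B
  int_poly_eval int_poly_eval_is_monoid_morphism.
End IntPolyEval.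

Lemma rmorph_int_poly_eval (B C : comPzRingType) (f : {rmorphism B -> C}) x p :
  f (int_poly_eval x p) = int_poly_eval (f x) p.
Proof.
rewrite rmorph_sum; apply: eq_bigr => i _.
by rewrite rmorphM rmorph_int rmorphXn.
Qed.

(** * Related elements generate the same ideal *)

Definition principal_ideal (A : comNzRingType) (e : A) : {pred A} :=
  fun x => `[< exists c, x = c * e >].

Lemma principal_idealP (A : comNzRingType) (e x : A) :
  reflect (exists c, x = c * e) (x \in principal_ideal e).
Proof. exact: asboolP. Qed.

Lemma principal_idealr_closed (A : comNzRingType) (e : A) :
  1 \notin principal_ideal e -> idealr_closed (principal_ideal e).
Proof.
move=> e1; split=> // [|a _ _ /principal_idealP[c ->] /principal_idealP[d ->]].
  by apply/principal_idealP; exists 0; rewrite mul0r.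
by apply/principal_idealP; exists (a * c + d); rewrite mulrDl mulrA.
Qed.

Lemma zd_rel_sym (R : zd_family) (A : comPzRingType) (a b : A) :
  R A a b -> R A b a.
Proof. by case: (zd_relP R A) => -[_ + _] _; apply. Qed.

Lemma zd_rel_eq0 (R : zd_family) (A : comPzRingType) (a : A) :
  R A 0 a -> a = 0.
Proof.
case: (zd_relP R A) => -[Rrefl _ _] Rmul a0.
by rewrite -[a]mulr1; apply: (Rmul _ _ 1 1 a0 (Rrefl 1)); rewrite mul0r.
Qed.

(** The images of [a] and [e] in the quotient of A by the ideal of [e] are
    still related, and that of [e] is 0; so [a] lies in the ideal. *)
Lemma zd_rel_dvd (R : zd_family) (A : comNzRingType) (a e : A) :
  R A a e -> exists c, a = c * e.
Proof.
move=> ae.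
(* If the ideal of [e] is the whole ring, then [e] is a unit; otherwise the
   quotient is a nonzero ring. *)
have [/principal_idealP[c e1]|e1] := boolP (1 \in principal_ideal e).
  by exists (a * c); rewrite -mulrA -e1 mulr1.
pose I : idealr A := HB.pack (principal_ideal e)
  (isIdealr.Build A _ (principal_idealr_closed e1)).
pose pr : {rmorphism A -> {ideal_quot I}} := (\pi_{ideal_quot I})%qT.
have pr0 x : pr x = 0 <-> x \in principal_ideal e.
  rewrite -(rmorph0 pr) -{2}[x]subr0; split=> [/eqP|x_e].
    by rewrite -Quotient.idealrBE.
  by apply/eqP; rewrite -Quotient.idealrBE.
apply/principal_idealP/pr0; apply: (@zd_rel_eq0 R).
have <- : pr e = 0 by apply/pr0/principal_idealP; exists 1; rewrite mul1r.
exact/zd_functorial/zd_rel_sym.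
Qed.

(** As ['X] and [e] divide each other in a domain, they differ by a unit, and
    the units of [{poly int}] are constants.  That the factor is constant is
    what matters: it takes the same value at any two points. *)
Lemma zd_rel_polyX (R : zd_family) (e : {poly int}) :
  R {poly int} 'X e -> exists c : int, 'X = c%:P * e.
Proof.
move=> Xe; have [c Xce] := zd_rel_dvd Xe.
have [d edX] := zd_rel_dvd (zd_rel_sym Xe).
have cd1 : d * c = 1.
  apply: (mulIf (negbT (polyX_eq0 int))).
  by rewrite mul1r -mulrA mulrCA -edX -Xce.
have : c \is a GRing.unit by apply/unitrP; exists d; rewrite cd1 mulrC cd1.
rewrite poly_unitE => /andP[/eqP c1 _].
by exists c`_0; rewrite -size1_polyC ?c1.
Qed.

(** * Equalizers of commutative rings *)

Section Equalizer.
Variables (A B : comPzRingType) (f g : {rmorphism A -> B}).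

Definition agree : {pred A} := [pred x | f x == g x].

Lemma agree_subring_closed : subring_closed agree.
Proof.
split=> [|x y /eqP fx /eqP fy|x y /eqP fx /eqP fy]; rewrite inE.
- by rewrite !rmorph1.
- by rewrite !rmorphB fx fy.
- by rewrite !rmorphM fx fy.
Qed.

Record equalizer :=
  Equalizer { equalizer_val :> A; _ : equalizer_val \in agree }.

HB.instance Definition _ := [isSub for equalizer_val].
HB.instance Definition _ := [Choice of equalizer by <:].
HB.instance Definition _ :=
  GRing.SubChoice_isSubComPzRing.Build A agree equalizer agree_subring_closed.

Lemma equalizer_eq (x : equalizer) : f (val x) = g (val x).
Proof. exact/eqP/(valP x). Qed.
End Equalizer.

(** The walking parallel pair: [false] is the common source, [true] the common
    target, and the two booleans in [pair_hom false true] are the two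
    arrows. *)
Definition pair_hom (a b : bool) : Type :=
  match a, b with
  | false, true => bool
  | true, false => void
  | _, _ => unit
  end.

Definition pair_id (a : bool) : pair_hom a a :=
  match a with false => tt | true => tt end.

Definition pair_comp (a b c : bool) :
    pair_hom b c -> pair_hom a b -> pair_hom a c :=
  match a, b, c with
  | false, false, _ => fun g _ => g
  | true, true, _ => fun g _ => g
  | false, true, true => fun _ f => f
  | false, true, false => fun g _ => match g with end
  | true, false, _ => fun _ f => match f with end
  end.

Lemma pair_comp_idl a b (f : pair_hom a b) : pair_comp (pair_id b) f = f.
Proof. by case: a b f => [] [] []. Qed.

Lemma pair_comp_idr a b (f : pair_hom a b) : pair_comp f (pair_id a) = f.
Proof. by case: a b f => [] [] []. Qed.

Lemma pair_comp_assoc a b c d (h : pair_hom c d) (g : pair_hom b c)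
    (f : pair_hom a b) :
  pair_comp h (pair_comp g f) = pair_comp (pair_comp h g) f.
Proof. by case: a b c d h g f => [] [] [] [] [] [] []. Qed.

Definition parallel_pair : category :=
  Category pair_comp_idl pair_comp_idr pair_comp_assoc.

Lemma finite_parallel_pair : finite_category parallel_pair.
Proof.
split; first by exists [:: false; true] => -[]; [right; left|left].
move=> [] [] /=.
- by exists [:: tt] => -[]; left.
- by exists [::] => -[].
- by exists [:: false; true] => -[]; [right; left|left].
- by exists [:: tt] => -[]; left.
Qed.

Section EqualizerDiagram.
Variables (A B : comPzRingType) (f g : {rmorphism A -> B}).

Definition pair_obj (a : bool) : comPzRingType := if a then B else A.

Definition pair_map (a b : bool) :
    pair_hom a b -> cring_hom (pair_obj a) (pair_obj b) :=
  match a, b with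
  | false, true => fun u => if u then g else f
  | true, false => fun u => match u with end
  | false, false => fun _ => cring_id A
  | true, true => fun _ => cring_id B
  end.

Lemma pair_map_id a : pair_map (pair_id a) = cring_id (pair_obj a).
Proof. by case: a. Qed.

Lemma pair_map_comp a b c (v : pair_hom b c) (u : pair_hom a b) :
  pair_map (pair_comp v u) = cring_comp (pair_map v) (pair_map u).
Proof. by case: a b c v u => [] [] [] [] []; apply: rmorphism_ext. Qed.

Definition pair_diagram : functor parallel_pair CRing :=
  @Functor parallel_pair CRing pair_obj pair_map pair_map_id pair_map_comp.

Definition equalizer_incl : {rmorphism equalizer f g -> A} := val.

Definition equalizer_leg (a : bool) : cring_hom (equalizer f g) (pair_obj a) :=
  match a with
  | false => equalizer_incl
  | true => cring_comp f equalizer_incl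
  end.

Lemma equalizer_leg_natural a b (u : pair_hom a b) :
  cring_comp (pair_map u) (equalizer_leg a) = equalizer_leg b.
Proof.
case: a b u => [] [] [] //; apply: rmorphism_ext => x //=.
exact/esym/equalizer_eq.
Qed.

Definition equalizer_cone : cone pair_diagram :=
  @Cone parallel_pair CRing pair_diagram (equalizer f g) equalizer_leg
    equalizer_leg_natural.

Section EqualizerLift.
Variables (C : comPzRingType) (h : {rmorphism C -> A}).
Hypothesis fgh : forall x, f (h x) = g (h x).

Definition equalizer_lift (x : C) : equalizer f g :=
  Equalizer (introT eqP (fgh x) : h x \in agree f g).

Lemma equalizer_lift_is_zmod_morphism : zmod_morphism equalizer_lift.
Proof. by move=> x y; apply: val_inj; rewrite /= rmorphB. Qed.

Lemma equalizer_lift_is_monoid_morphism : monoid_morphism equalizer_lift.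
Proof.
by split=> [|x y]; apply: val_inj; rewrite /= ?rmorph1 ?rmorphM.
Qed.

HB.instance Definition _ := GRing.isZmodMorphism.Build C (equalizer f g)
  equalizer_lift equalizer_lift_is_zmod_morphism.
HB.instance Definition _ := GRing.isMonoidMorphism.Build C (equalizer f g)
  equalizer_lift equalizer_lift_is_monoid_morphism.

Definition equalizer_lift_hom : cring_hom C (equalizer f g) :=
  (equalizer_lift : {rmorphism C -> equalizer f g}).
End EqualizerLift.

Lemma equalizer_is_limit : is_limit equalizer_cone.
Proof.
move=> c.
pose h : {rmorphism (apex c : comPzRingType) -> A} := leg c false.
have hB (u : bool) x : pair_map (a := false) (b := true) u (h x) = leg c true x.
  by rewrite -(leg_natural c (u : @hom parallel_pair false true)).
have fgh x : f (h x) = g (h x) by rewrite (hB false) (hB true).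
exists (equalizer_lift_hom fgh); split=> [[]|v cv].
- by apply: rmorphism_ext => x; rewrite -(hB false).
- exact: rmorphism_ext.
apply: rmorphism_ext => x; apply: val_inj.
by rewrite /= -[RHS]/(cring_comp equalizer_incl v x) [cring_comp _ _](cv false).
Qed.
End EqualizerDiagram.

(** * Consequences of preserving equalizers *)

(** Without a loop, so that its morphisms to a graph are the vertices of the
    latter, whether or not these carry a loop. *)
Definition one_vertex_graph : graph :=
  @MkGraph unit (fun _ _ => False) (fun _ _ e => e).

Definition graph_point (G : graph) (x : G) : graph_hom one_vertex_graph G :=
  @GraphHom one_vertex_graph G (fun _ => x) (fun _ _ e => False_ind _ e).

Lemma graph_hom_congr (G H : graph) (f g : graph_hom G H) : f = g -> f =1 g.
Proof. by move->. Qed.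

(** The class of [a] is a vertex equalized by the maps induced by [f] and [g],
    so it comes from a vertex of the graph of the equalizer; a representative
    of that vertex is the required [e]. *)
Lemma preserves_equalizer_lift (R : zd_family) (A B : comPzRingType)
    (f g : {rmorphism A -> B}) (a : A) :
  preserves_finite_limits (zd_functor R) -> R B (f a) (g a) ->
  exists2 e : A, f e = g e & R A a e.
Proof.
move=> Rlim fga.
pose x (j : bool) : zd_quot R (pair_obj A B j) :=
  if j return zd_quot R (pair_obj A B j) then zd_class R (f a)
  else zd_class R a.
have xP (i j : bool) (u : pair_hom i j) : zd_fun (pair_map f g u) (x i) = x j.
  case: i j u => [] [] [] //=; rewrite zd_funE //.
  exact/zd_classP/zd_rel_sym.
pose p j := graph_point (G := zd_graph R (pair_obj A B j)) (x j).
have pP (i j : bool) (u : pair_hom i j) :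
    graph_comp (zd_map R (pair_map f g u)) (p i) = p j.
  by apply: graph_hom_ext => v; exact: xP.
pose c : cone (functor_comp (zd_functor R) (pair_diagram f g)) :=
  @Cone _ _ (functor_comp (zd_functor R) (pair_diagram f g)) one_vertex_graph
    p pP.
have [u [uP _]] :=
  Rlim _ finite_parallel_pair _ _ (@equalizer_is_limit A B f g) c.
pose e : equalizer f g := zd_repr (u tt).
exists (val e); first exact: equalizer_eq.
apply/zd_classP; rewrite -(zd_funE R (equalizer_incl f g)) zd_reprK.
exact/esym/(graph_hom_congr (uP false) tt).
Qed.

(** The previous lemma is applied to the universal case: evaluation at [u] and
    at [v], and the element ['X]. *)
Lemma preserves_zd_rel_eq (R : zd_family) (B : comPzRingType) (u v : B) :
  preserves_finite_limits (zd_functor R) -> R B u v -> u = v.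
Proof.
move=> Rlim uv.
have [|e uve /zd_rel_polyX[c Xce]] :=
  @preserves_equalizer_lift R _ _ (int_poly_eval u) (int_poly_eval v) 'X Rlim.
  by rewrite /= !int_poly_evalX.
rewrite -[LHS]int_poly_evalX -[RHS]int_poly_evalX Xce !rmorphM /= uve.
by rewrite !int_poly_evalC.
Qed.

Lemma zd_family_ext (R S : zd_family) :
  (forall A a b, R A a b <-> S A a b) -> R = S.
Proof.
case: R S => [r rP rf] [s sP sf] /= rs.
have rsE : r = s.
  apply: functional_extensionality_dep => A.
  by apply/funext => a; apply/funext => b; apply/propext.
by subst s; rewrite (Prop_irrelevance rP sP) (Prop_irrelevance rf sf).
Qed.

(** * The trivial family *)

Definition int_poly_eval_hom (B : comPzRingType) (x : B) :
    cring_hom {poly int} B :=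
  (int_poly_eval x : {rmorphism {poly int} -> B}).

Definition cring_fun (A B : comPzRingType) (f : cring_hom A B) : A -> B :=
  (f : {rmorphism A -> B}).

(** A compatible family of elements is the same as a cone with apex
    [{poly int}], and an element of the limit the same as a morphism from
    [{poly int}] to it. *)
Lemma cring_limit_elements (J : category) (X : functor J CRing) (c : cone X)
    (x : forall j, (X j : comPzRingType)) :
  is_limit c -> (forall i j (u : hom i j), cring_fun (fmap X u) (x i) = x j) ->
  exists! a : (apex c : comPzRingType), forall j, cring_fun (leg c j) a = x j.
Proof.
move=> climit xP.
have evP i j (u : hom i j) :
    cring_comp (fmap X u) (int_poly_eval_hom (x i)) = int_poly_eval_hom (x j).
  by apply: rmorphism_ext => p; rewrite /= rmorph_int_poly_eval [_ (x i)]xP.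
pose d : cone X :=
  @Cone _ _ X ({poly int} : comPzRingType)
    (fun j => int_poly_eval_hom (x j)) evP.
have [m [mP m_uniq]] := climit d.
exists (cring_fun m 'X); split=> [j|a aP].
  rewrite -[LHS]/(cring_fun (cring_comp (leg c j) m) 'X) [cring_comp _ _]mP.
  exact: int_poly_evalX.
rewrite (m_uniq (int_poly_eval_hom a)) => [|j]; first exact: int_poly_evalX.
apply: rmorphism_ext => p /=.
by rewrite rmorph_int_poly_eval [_ a]aP.
Qed.

Lemma trivial_zd_class_inj (A : comPzRingType) :
  injective (@zd_class trivial_zd_family A).
Proof. by move=> a b /zd_classP. Qed.

(** A cone of graphs gives, at each vertex of its apex, a compatible family of
    elements, hence an element of the limit.  Adjacency is checked after
    applying the legs, which are jointly injective. *)
Lemma trivial_preserves_limits (J : category) (X : functor J CRing)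
    (c : cone X) :
  is_limit c -> is_limit (map_cone (zd_functor trivial_zd_family) c).
Proof.
move=> climit d.
pose x v j : (X j : comPzRingType) :=
  zd_repr (leg d j v : zd_quot trivial_zd_family (X j)).
have xP v i j (u : hom i j) : cring_fun (fmap X u) (x v i) = x v j.
  apply: trivial_zd_class_inj.
  rewrite -[LHS]/(zd_fun (fmap X u) (leg d i v)) zd_reprK.
  exact: (graph_hom_congr (leg_natural d u) v).
have xM v w j : adj v w -> x v j * x w j = 0 :=
   @graph_hom_adj _ _ (leg d j) v w.
have [a aP] := choice (fun v => cring_limit_elements climit (xP v)).
have legs_inj b b' :
    (forall j, cring_fun (leg c j) b = cring_fun (leg c j) b') -> b = b'.
  move=> bb'.
  have compat i j (u : hom i j) :
      cring_fun (fmap X u) (cring_fun (leg c i) b) = cring_fun (leg c j) b.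
    by rewrite -(leg_natural c u).
  have [b0 [_ b0_uniq]] := cring_limit_elements climit compat.
  by rewrite -(b0_uniq b) // (b0_uniq b').
have aM v w : adj v w ->
    zd_adj (zd_class trivial_zd_family (a v))
      (zd_class trivial_zd_family (a w)).
  move=> vw; apply/zd_adjE/legs_inj => j; rewrite /cring_fun rmorphM rmorph0.
  by rewrite [_ (a v)](proj1 (aP v)) [_ (a w)](proj1 (aP w)) xM.
exists (@GraphHom (apex d) (zd_graph trivial_zd_family (apex c))
  (fun v => zd_class trivial_zd_family (a v)) aM).
split=> [j|m mP].
  apply: graph_hom_ext => v /=; rewrite zd_funE -[RHS]zd_reprK.
  by congr zd_class; have [+ _] := aP v; apply.
apply: graph_hom_ext => v /=; rewrite -[RHS]zd_reprK; congr zd_class.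
have [_] := aP v; apply => j; apply: trivial_zd_class_inj.
rewrite [RHS]zd_reprK.
exact: (graph_hom_congr (mP j) v).
Qed.

Theorem proposition3p17 (R : zd_family) :
  preserves_finite_limits (zd_functor R) <-> R = trivial_zd_family.
Proof.
split=> [Rlim|-> J _ X c]; last exact: trivial_preserves_limits.
apply: zd_family_ext => A a b; split=> [/(preserves_zd_rel_eq Rlim)//|->].
by case: (zd_relP R A) => -[].
Qed.
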